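(* Let $K$ be a field and let $x,y,z$ be indeterminates over $K$. Then the extension $K[x,y][[z]]\hookrightarrow K[x,y]_x[[z]]$ is not a TGF extension.
   Context: $K[x,y]_x$ denotes the fraction ring $K[x,y,1/x]$. An extension $R\subseteq S$ of integral domains is called a trivial generic fiber (TGF) extension if every nonzero prime ideal of $S$ has nonzero intersection with $R$. *)

(* Defs.v *)
(* MathComp, with the classical axioms of mathcomp.classical.boolp *)
From HB Require Import structures.
From mathcomp Require Import all_boot all_order all_algebra.
From mathcomp Require Import boolp.

Set Implicit Arguments.
Unset Strict Implicit.
Unset Printing Implicit Defensive.

Import GRing.Theory.
Local Open Scope ring_scope.

Reserved Notation "{ 'fps' R }" (format "{ 'fps'  R }").

(* A decidable unit group is part of the interface idomainType; here it is
   obtained classically. *)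
Section ClassicalUnits.
Variable R : comNzRingType.

Definition cunit : {pred R} := fun x => `[< exists y, y * x = 1 >].

Definition cinv (x : R) : R :=
  if pselect (exists y, y * x = 1) is left ex then projT1 (cid ex) else x.

Lemma cmulVx : {in cunit, left_inverse 1 cinv *%R}.
Proof.
move=> x; rewrite unfold_in => /asboolP ex; rewrite /cinv.
by case: pselect => // ex'; apply: (projT2 (cid ex')).
Qed.

Lemma cunitPl (x y : R) : y * x = 1 -> cunit x.
Proof. by move=> yx; apply/asboolP; exists y. Qed.

Lemma cinv_out : {in [predC cunit], cinv =1 id}.
Proof.
move=> x; rewrite !inE unfold_in => /asboolPn nex.
by rewrite /cinv; case: pselect.
Qed.

End ClassicalUnits.

Section Localization.
Variables (R : idomainType) (a : R).

(* R[1/a] for a != 0, as the subring of {fraction R} of all p / a ^ n. *)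
Definition away_pred : {pred {fraction R}} :=
  fun f => `[< exists (p : R) (n : nat), f = tofrac p / tofrac a ^+ n >].

Lemma away_subring_closed : subring_closed away_pred.
Proof.
have normal f : f \in away_pred -> a = 0 -> exists p, f = tofrac p.
  rewrite unfold_in => /asboolP[p [n ->]] ->; rewrite rmorph0 expr0n.
  case: n => [|n] /=; first by exists p; rewrite divr1.
  by exists 0; rewrite invr0 mulr0 rmorph0.
split.
- by apply/asboolP; exists 1, 0%N; rewrite expr0 divr1 rmorph1.
- move=> f g fA gA; have [a0|a_neq0] := eqVneq a 0.
    have [[p ->] [q ->]] := (normal f fA a0, normal g gA a0).
    by apply/asboolP; exists (p - q), 0%N; rewrite expr0 divr1 rmorphB.
  move: fA gA; rewrite !unfold_in => /asboolP[p [n ->]] /asboolP[q [m ->]].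
  apply/asboolP; exists (p * a ^+ m - q * a ^+ n), (n + m)%N.
  have aF k : tofrac a ^+ k != 0 by rewrite expf_neq0 // tofrac_eq0.
  rewrite -mulNr addf_div // exprD rmorphB !rmorphM !rmorphXn /=.
  by rewrite mulNr.
- move=> f g; rewrite !unfold_in => /asboolP[p [n ->]] /asboolP[q [m ->]].
  apply/asboolP; exists (p * q), (n + m)%N.
  by rewrite mulf_div exprD rmorphM.
Qed.

HB.instance Definition _ :=
  GRing.isSubringClosed.Build {fraction R} away_pred away_subring_closed.

Record away := Away { away_val : {fraction R}; _ : away_val \in away_pred }.

HB.instance Definition _ := [isSub for away_val].
HB.instance Definition _ := [Choice of away by <:].
HB.instance Definition _ := [SubChoice_isSubComNzRing of away by <:].
HB.instance Definition _ := GRing.ComNzRing_hasMulInverse.Build away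
  (@cmulVx away) (@cunitPl away) (@cinv_out away).

Lemma away_mulf_eq0 : GRing.integral_domain_axiom away.
Proof.
move=> f g fg; have /eqP := congr1 val fg.
by rewrite rmorphM rmorph0 mulf_eq0 -!(rmorph0 (val : away -> _)) !val_eqE.
Qed.

HB.instance Definition _ := GRing.ComUnitRing_isIntegral.Build away away_mulf_eq0.

Lemma tofrac_away (p : R) : tofrac p \in away_pred.
Proof. by apply/asboolP; exists p, 0%N; rewrite expr0 divr1. Qed.

Definition to_away (p : R) : away := Away (tofrac_away p).

Lemma to_away_is_zmod_morphism : zmod_morphism to_away.
Proof. by move=> p q; apply: val_inj; rewrite /= rmorphB. Qed.

Lemma to_away_is_monoid_morphism : monoid_morphism to_away.
Proof. by split=> [|p q]; apply: val_inj; rewrite /= ?rmorph1 ?rmorphM. Qed.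

HB.instance Definition _ :=
  GRing.isZmodMorphism.Build R away to_away to_away_is_zmod_morphism.
HB.instance Definition _ :=
  GRing.isMonoidMorphism.Build R away to_away to_away_is_monoid_morphism.

Lemma to_away_inj : injective to_away.
Proof. by move=> p q /(congr1 val)/eqP; rewrite /= tofrac_eq => /eqP. Qed.

End Localization.

(* R[[z]], the series sum_n (fps_coef f n) z^n.  It is a record because the
   function type nat -> R already carries pointwise operations. *)
Record fps (R : Type) := FPS { fps_coef : nat -> R }.

Notation "{ 'fps' R }" := (fps R) : type_scope.

HB.instance Definition _ (R : Type) := gen_eqMixin {fps R}.
HB.instance Definition _ (R : Type) := gen_choiceMixin {fps R}.

Lemma fpsP (R : Type) (f g : {fps R}) : fps_coef f =1 fps_coef g <-> f = g.
Proof. by case: f g => f [g]; split=> [/funext /= ->|->]. Qed.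

Section PowerSeriesRing.
Variable R : comNzRingType.
Implicit Types f g h : {fps R}.

Definition fps_zero : {fps R} := FPS (fun=> 0).
Definition fps_opp f : {fps R} := FPS (fun n => - fps_coef f n).
Definition fps_add f g : {fps R} := FPS (fun n => fps_coef f n + fps_coef g n).
Definition fps_one : {fps R} := FPS (fun n => (n == 0)%N%:R).
Definition fps_mul f g : {fps R} :=
  FPS (fun n => \sum_(i < n.+1) fps_coef f i * fps_coef g (n - i)%N).

Lemma fps_addA : associative fps_add.
Proof. by move=> f g h; apply/fpsP => n; apply: addrA. Qed.
Lemma fps_addC : commutative fps_add.
Proof. by move=> f g; apply/fpsP => n; apply: addrC. Qed.
Lemma fps_add0 : left_id fps_zero fps_add.
Proof. by move=> f; apply/fpsP => n; apply: add0r. Qed.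
Lemma fps_addN : left_inverse fps_zero fps_opp fps_add.
Proof. by move=> f; apply/fpsP => n; apply: addNr. Qed.

HB.instance Definition _ :=
  GRing.isZmodule.Build {fps R} fps_addA fps_addC fps_add0 fps_addN.

(* The first n + 1 terms of f, as a polynomial. *)
Definition fps_trunc n f : {poly R} := \poly_(i < n.+1) fps_coef f i.

Lemma coef_fps_trunc n f i : (i <= n)%N -> (fps_trunc n f)`_i = fps_coef f i.
Proof. by move=> le_in; rewrite coef_poly ltnS le_in. Qed.

Lemma fps_coef_mul n f g i : (i <= n)%N ->
  fps_coef (fps_mul f g) i = (fps_trunc n f * fps_trunc n g)`_i.
Proof.
move=> le_in; rewrite coefM; apply: eq_bigr => -[j /= lt_ji] _.
by rewrite !coef_fps_trunc // (leq_trans _ le_in) ?leq_subr // -ltnS.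
Qed.

Lemma fps_mulA : associative fps_mul.
Proof.
move=> f g h; apply/fpsP => n.
have trunc_mul p q k i : (i <= k)%N ->
    (fps_trunc k (fps_mul p q))`_i = (fps_trunc k p * fps_trunc k q)`_i.
  by move=> le_ik; rewrite coef_fps_trunc // (fps_coef_mul _ _ le_ik).
rewrite !(@fps_coef_mul n) //.
transitivity (fps_trunc n f * (fps_trunc n g * fps_trunc n h))`_n.
  rewrite !coefM; apply: eq_bigr => i _.
  by rewrite trunc_mul // leq_subr.
rewrite mulrA !(coefM _ (fps_trunc n h)); apply: eq_bigr => i _.
by rewrite trunc_mul // -ltnS.
Qed.

Lemma fps_mulC : commutative fps_mul.
Proof. by move=> f g; apply/fpsP => n; rewrite !(@fps_coef_mul n) // mulrC. Qed.

Lemma fps_mul1 : left_id fps_one fps_mul.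
Proof.
move=> f; apply/fpsP => n; rewrite /= big_ord_recl /= mul1r subn0.
by rewrite big1 ?addr0 // => i _; rewrite mul0r.
Qed.

Lemma fps_mulDl : left_distributive fps_mul fps_add.
Proof.
move=> f g h; apply/fpsP => n /=; rewrite -big_split /=.
by apply: eq_bigr => i _; rewrite mulrDl.
Qed.

Lemma fps_one_neq0 : fps_one != fps_zero.
Proof. by apply/eqP => /fpsP/(_ 0%N)/eqP; rewrite /= oner_eq0. Qed.

HB.instance Definition _ := GRing.Zmodule_isComNzRing.Build {fps R}
  fps_mulA fps_mulC fps_mul1 fps_mulDl fps_one_neq0.
HB.instance Definition _ := GRing.ComNzRing_hasMulInverse.Build {fps R}
  (@cmulVx {fps R}) (@cunitPl {fps R}) (@cinv_out {fps R}).

End PowerSeriesRing.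

Section PowerSeriesDomain.
Variable R : idomainType.

Lemma fps_mulf_eq0 : GRing.integral_domain_axiom {fps R}.
Proof.
move=> f g fg0; apply/norP => -[f0 g0].
have nz (h : {fps R}) : h != 0 -> exists n, fps_coef h n != 0.
  move=> h0; apply: contrapT => nex; case/eqP: h0; apply/fpsP => n /=.
  by apply/eqP; apply: contrapT => hn; apply: nex; exists n; apply/negP.
have := fg0; case: (ex_minnP (nz f f0)) => m fm minm.
case: (ex_minnP (nz g g0)) => k gk mink /fpsP/(_ (m + k)%N) /= sum0.
have mlt : (m < (m + k).+1)%N by rewrite ltnS leq_addr.
move: sum0; rewrite (bigD1 (Ordinal mlt)) //= addKn big1 ?addr0.
  by move/eqP; rewrite mulf_eq0 (negPf fm) (negPf gk).
move=> i ne_im; have {ne_im}: (i : nat) != m by [].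
rewrite neq_ltn => /orP[lt_im|lt_mi].
  have /eqP -> : fps_coef f i == 0.
    by apply: contraLR lt_im => /minm; rewrite -leqNgt.
  by rewrite mul0r.
have /eqP -> : fps_coef g (m + k - i)%N == 0.
  apply: contraLR lt_mi => /mink; rewrite -leqNgt => le_k.
  have := leq_add le_k (leqnn i).
  by rewrite subnK; [rewrite addnC leq_add2r | rewrite -ltnS].
by rewrite mulr0.
Qed.

HB.instance Definition _ :=
  GRing.ComUnitRing_isIntegral.Build {fps R} fps_mulf_eq0.

End PowerSeriesDomain.

Section PowerSeriesMap.
Variables (R S : comNzRingType) (phi : {rmorphism R -> S}).

Definition fps_map (f : {fps R}) : {fps S} := FPS (fun n => phi (fps_coef f n)).

Lemma fps_map_is_zmod_morphism : zmod_morphism fps_map.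
Proof. by move=> f g; apply/fpsP => n; apply: (rmorphB phi). Qed.

Lemma fps_map_is_monoid_morphism : monoid_morphism fps_map.
Proof.
split=> [|f g]; apply/fpsP => n /=; first by rewrite rmorph_nat.
by rewrite rmorph_sum; apply: eq_bigr => i _; rewrite rmorphM.
Qed.

HB.instance Definition _ := GRing.isZmodMorphism.Build {fps R} {fps S}
  fps_map fps_map_is_zmod_morphism.
HB.instance Definition _ := GRing.isMonoidMorphism.Build {fps R} {fps S}
  fps_map fps_map_is_monoid_morphism.

Lemma fps_map_inj : injective phi -> injective fps_map.
Proof.
by move=> phi_inj f g /fpsP fg; apply/fpsP => n; apply: phi_inj (fg n).
Qed.

End PowerSeriesMap.

(* Trivial generic fiber.  R is a subring of S through the embedding i, so the
   intersection of P with R is the preimage of P under i.  Classically, the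
   boolean predicates underlying prime_idealr are arbitrary subsets of S, and
   prime_idealr includes properness. *)
Definition TGF (R S : idomainType) (i : {rmorphism R -> S})
    (_ : injective i) : Prop :=
  forall P : prime_idealr S,
    (exists2 s : S, s \in (P : {pred S}) & s != 0) ->
    exists2 r : R, r != 0 & i r \in (P : {pred S}).

Arguments TGF {R S} i _.

Section TheExtension.
Variable K : fieldType.

(* K[x,y] is read as K[x][y]: x is the inner variable, y the outer one. *)
Definition Kxy : idomainType := {poly {poly K}}.
Definition varx : Kxy := 'X%:P.

Definition Kxy_x : idomainType := away varx.

Definition Kxy_to_Kxy_x : {rmorphism Kxy -> Kxy_x} := @to_away Kxy varx.

(* K[x,y][[z]] -> K[x,y]_x[[z]], coefficientwise. *)
Definition extension : {rmorphism {fps Kxy} -> {fps Kxy_x}} :=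
  fps_map Kxy_to_Kxy_x.

Lemma extension_inj : injective extension.
Proof. exact: fps_map_inj (@to_away_inj Kxy varx). Qed.

End TheExtension.

(* Main.v *)
Require Import Defs.
From HB Require Import structures.
From mathcomp Require Import all_boot all_order all_algebra.
From mathcomp Require Import boolp zify ring.

Set Implicit Arguments.
Unset Strict Implicit.
Unset Printing Implicit Defensive.

Import GRing.Theory.
Local Open Scope ring_scope.

(** Write D = K[x], t = x and let F be the fraction field of D.  Consider
    sigma = sum_n t^(-a_n) z^(n+1) in F[[z]], where a_n = (2n)! grows
    superexponentially.  Sending y to sigma, and z to z, defines a ring
    morphism from K[x,y]_x[[z]] to the domain F[[z]].  Its kernel P is a prime
    ideal, and P is nonzero because it contains y - sigma, whose coefficients
    only need x to be inverted.  It remains to see that P meets K[x,y][[z]]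
    only in 0, that is, that sigma is a root of no nonzero series
    f = sum_n f_n(y) z^n with f_n in D[y]: this is eval_lacunary_neq0.

    The argument is of Liouville type.  Let D_j f be the j-th Hasse derivative
    of f in y, let d be the least j with (D_j f)(sigma) <> 0, which exists when
    f <> 0 (eval_nderiv_neq0), and let h z^e be the lowest term of
    (D_d f)(sigma).  If f(sigma) = 0, then d > 0.  Let sigma_k be the sum of
    the terms of sigma of degree at most k+1 in z, so that
    sigma_k = sigma - t^(-a_(k+1)) z^(k+2) - ... .  By Taylor's formula, for
    k >= e the coefficient of f(sigma_k) at z^N, with N = e + d (k+2), is
    h (- t^(-a_(k+1)))^d (eval_leading).  On the other hand, the poles of the
    coefficients of sigma_k, hence those of f(sigma_k), have slope at most a_k:
    multiplied by t^(a_k N), the coefficient at z^N lies in D (eval_slope).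
    A bound linear in N is the best to expect here, as the degrees in y of the
    f_n are arbitrary.  Therefore h lies in t^(d a_(k+1) - a_k N) D.  The
    exponent is unbounded as k grows (pole_growth), so h = 0, a contradiction.

    Hasse derivatives, rather than ordinary ones, make the argument independent
    of the characteristic of K. *)

(** * Coefficients of power series *)

Section SeriesCoefficients.
Variable R : comNzRingType.
Implicit Types f g : {fps R}.

Lemma fps_coefD f g n : fps_coef (f + g) n = fps_coef f n + fps_coef g n.
Proof. by []. Qed.

Lemma fps_coefM f g n :
  fps_coef (f * g) n = \sum_(i < n.+1) fps_coef f i * fps_coef g (n - i).
Proof. by []. Qed.

Lemma fps_coef_sum (I : Type) (r : seq I) (P : pred I) (F : I -> {fps R}) n :
  fps_coef (\sum_(i <- r | P i) F i) n = \sum_(i <- r | P i) fps_coef (F i) n.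
Proof. by elim/big_rec2: _ => // i _ f _ <-. Qed.

Definition fpsC (c : R) : {fps R} := FPS (fun n => c *+ (n == 0)%N).

Lemma fps_coefCM c f n : fps_coef (fpsC c * f) n = c * fps_coef f n.
Proof.
rewrite fps_coefM big_ord_recl /= subn0 mulr1n big1 ?addr0 // => i _.
by rewrite mulr0n mul0r.
Qed.

Lemma fpsC_is_zmod_morphism : zmod_morphism fpsC.
Proof. by move=> c d; apply/fpsP => n /=; rewrite mulrnBl. Qed.

Lemma fpsC_is_monoid_morphism : monoid_morphism fpsC.
Proof.
by split=> [|c d]; apply/fpsP => n //; rewrite fps_coefCM /= mulrnAr.
Qed.

HB.instance Definition _ :=
  GRing.isZmodMorphism.Build R {fps R} fpsC fpsC_is_zmod_morphism.
HB.instance Definition _ :=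
  GRing.isMonoidMorphism.Build R {fps R} fpsC fpsC_is_monoid_morphism.

Definition fpsZ : {fps R} := FPS (fun n => (n == 1)%N%:R).

Lemma fps_coefZnM k f n :
  fps_coef (fpsZ ^+ k * f) n = if (n < k)%N then 0 else fps_coef f (n - k).
Proof.
elim: k n => [|k IHk] n; first by rewrite expr0 mul1r subn0.
rewrite exprS -mulrA fps_coefM; case: n => [|n].
  by rewrite big_ord1 /= mul0r.
rewrite big_ord_recl /= mul0r add0r big_ord_recl /= mul1r.
rewrite [X in _ + X]big1 ?addr0.
  by rewrite -fps_coefM -[(n.+1 - bump 0 0)%N]/(n - 0)%N subn0 IHk ltnS subSS.
by move=> i _; rewrite mul0r.
Qed.

Lemma fps_neq0 f : f != 0 -> exists n, fps_coef f n != 0.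
Proof.
move=> f0; apply: contrapT => nex; case/eqP: f0; apply/fpsP => n.
by apply/eqP; apply: contrapT => fn; apply: nex; exists n; apply/negP.
Qed.

End SeriesCoefficients.

Arguments fpsZ {R}.

(** * Extending a morphism from coefficients to power series *)

Section Substitution.
Variables (B A : comNzRingType) (theta : {rmorphism B -> {fps A}}).

(** The extension of theta to polynomials in z, with z sent to z.  Modulo
    z^(N+1) it determines the extension to power series. *)
Definition poly_lift : {poly B} -> {fps A} :=
  horner_eval fpsZ \o map_poly theta.

HB.instance Definition _ := GRing.RMorphism.on poly_lift.

Lemma poly_lift_trunc N f :
  poly_lift (fps_trunc N f) =
    \sum_(i < N.+1) theta (fps_coef f i) * fpsZ ^+ i.
Proof.
rewrite /poly_lift /= horner_evalE (@horner_coef_wide _ N.+1); last first.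
  exact: leq_trans (size_poly _ _) (size_poly _ _).
by apply: eq_bigr => i _; rewrite coef_map coef_fps_trunc // -ltnS.
Qed.

Lemma poly_liftXn n : poly_lift 'X^n = fpsZ ^+ n.
Proof. by rewrite /poly_lift /= horner_evalE map_polyXn hornerXn. Qed.

Lemma poly_lift_congr N (p q : {poly B}) :
    (forall i, (i <= N)%N -> p`_i = q`_i) ->
  forall n, (n <= N)%N -> fps_coef (poly_lift p) n = fps_coef (poly_lift q) n.
Proof.
move=> pq n le_nN.
have low (r : {poly B}) :
    fps_coef (poly_lift r) n = fps_coef (poly_lift (take_poly N.+1 r)) n.
  rewrite -{1}(poly_take_drop N.+1 r) rmorphD rmorphM fps_coefD.
  by rewrite mulrC [X in X * _]poly_liftXn fps_coefZnM ltnS le_nN addr0.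
rewrite low [RHS]low; congr (fps_coef (poly_lift _) n).
by apply/polyP => i; rewrite !coef_take_poly ltnS; case: leqP => // /pq.
Qed.

(** The infinite sum of the theta(f_n) z^n, whose coefficient at z^n only
    depends on the terms of f of degree at most n. *)
Definition fps_lift (f : {fps B}) : {fps A} :=
  FPS (fun n => fps_coef (poly_lift (fps_trunc n f)) n).

Lemma fps_coef_lift N f n : (n <= N)%N ->
  fps_coef (fps_lift f) n = fps_coef (poly_lift (fps_trunc N f)) n.
Proof.
move=> le_nN; apply: (@poly_lift_congr n) => // i le_in.
by rewrite !coef_fps_trunc // (leq_trans le_in).
Qed.

Lemma fps_lift_is_zmod_morphism : zmod_morphism fps_lift.
Proof.
move=> f g; apply/fpsP => n; rewrite /fps_lift /=.
have -> : fps_trunc n (f - g) = fps_trunc n f - fps_trunc n g.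
  apply/polyP => i; rewrite coefB !coef_poly; case: ifP => // _.
  by rewrite subr0.
by rewrite rmorphB.
Qed.

Lemma fps_lift_is_monoid_morphism : monoid_morphism fps_lift.
Proof.
split=> [|f g]; apply/fpsP => n.
  rewrite -[RHS]/(fps_coef 1 n) -(rmorph1 poly_lift).
  by apply: (@poly_lift_congr n) => // i le_in; rewrite coef_fps_trunc // coef1.
rewrite [LHS]/=.
rewrite (@poly_lift_congr n _ (fps_trunc n f * fps_trunc n g)) //; last first.
  by move=> i le_in; rewrite coef_fps_trunc // (fps_coef_mul _ _ le_in).
rewrite rmorphM !fps_coefM; apply: eq_bigr => i _.
by rewrite -!fps_coef_lift ?leq_subr // -ltnS.
Qed.

HB.instance Definition _ := GRing.isZmodMorphism.Build {fps B} {fps A}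
  fps_lift fps_lift_is_zmod_morphism.
HB.instance Definition _ := GRing.isMonoidMorphism.Build {fps B} {fps A}
  fps_lift fps_lift_is_monoid_morphism.

Lemma fps_liftC b : fps_lift (fpsC b) = theta b.
Proof.
apply/fpsP => n; rewrite [LHS]/= poly_lift_trunc.
rewrite big_ord_recl expr0 mulr1 big1 => [|i _].
  by rewrite [X in fps_coef X]addr0.
by rewrite [fps_coef _ _]/= mulr0n rmorph0 mul0r.
Qed.

Lemma fps_lift_const (f : {fps B}) (g : {fps A}) :
    (forall n, theta (fps_coef f n) = fpsC (fps_coef g n)) ->
  fps_lift f = g.
Proof.
move=> fg; apply/fpsP => n; rewrite [LHS]/= poly_lift_trunc fps_coef_sum.
rewrite big_ord_recr big1 => [|i _]; rewrite fg mulrC fps_coefZnM.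
  by rewrite ltnn subnn; apply: add0r.
have lt_in := ltn_ord i; rewrite ltnNge (ltnW lt_in) /=.
by rewrite -subn_gt0 in lt_in; rewrite -(prednK lt_in) mulr0n.
Qed.

End Substitution.

(** * The universal property of the localization *)

Section LocalizationLift.
Variables (R : idomainType) (a : R) (T : comUnitRingType).
Variable psi : {rmorphism R -> T}.

Lemma away_fraction (f : away a) :
  exists pn : R * nat, val f = tofrac pn.1 / tofrac a ^+ pn.2.
Proof. by case: f => f /= /asboolP[p [n fE]]; exists (p, n). Qed.

(** The proof that psi a is a unit is an argument so that the morphism
    structures below, which rest on it, can be inferred from the term. *)
Definition away_lift of psi a \is a GRing.unit := fun f : away a =>
  let pn := projT1 (cid (away_fraction f)) in psi pn.1 / psi a ^+ pn.2.

Hypothesis psi_unit : psi a \is a GRing.unit.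
Local Notation lift := (away_lift psi_unit).

Lemma away_denominator_neq0 k : tofrac a ^+ k != 0.
Proof.
rewrite expf_neq0 // tofrac_eq0; apply: contraTneq psi_unit => ->.
by rewrite rmorph0 unitr0.
Qed.

Lemma away_liftE (f : away a) p n :
  val f = tofrac p / tofrac a ^+ n -> lift f = psi p / psi a ^+ n.
Proof.
rewrite /away_lift; case: cid => -[q m] /= -> qp.
have aF := away_denominator_neq0.
have psiU k : psi a ^+ k \is a GRing.unit by rewrite unitrX.
have {}qp : q * a ^+ n = p * a ^+ m.
  by apply/eqP; rewrite -tofrac_eq !rmorphM !rmorphXn -eqr_div // qp.
apply: (mulIr (psiU m)); rewrite /= divrK // mulrAC.
apply: (mulIr (psiU n)); rewrite /= divrK //.
by rewrite -!rmorphXn -!rmorphM qp.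
Qed.

Lemma away_lift_to_away p : lift (to_away a p) = psi p.
Proof. by rewrite (@away_liftE _ p 0) ?expr0 ?divr1. Qed.

Lemma away_common_denominator (f g : away a) : exists p q n,
  val f = tofrac p / tofrac a ^+ n /\ val g = tofrac q / tofrac a ^+ n.
Proof.
have [[[p n] /= fE] [[q m] /= gE]] := (away_fraction f, away_fraction g).
exists (p * a ^+ m), (q * a ^+ n), (n + m)%N.
have aF := away_denominator_neq0.
rewrite fE gE exprD !rmorphM !rmorphXn; split.
  by rewrite -mulf_div divff ?mulr1.
by rewrite [tofrac a ^+ n * _]mulrC -mulf_div divff ?mulr1.
Qed.

Lemma away_lift_is_zmod_morphism : zmod_morphism lift.
Proof.
move=> f g; have [p [q [n [fE gE]]]] := away_common_denominator f g.
rewrite (away_liftE fE) (away_liftE gE) -mulrBl -rmorphB.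
by apply: away_liftE; rewrite [tofrac _]rmorphB mulrBl -fE -gE.
Qed.

Lemma away_lift_is_monoid_morphism : monoid_morphism lift.
Proof.
split=> [|f g].
  by rewrite (@away_liftE _ 1 0) ?expr0 ?divr1 ?rmorph1.
have [p [q [n [fE gE]]]] := away_common_denominator f g.
rewrite (away_liftE fE) (away_liftE gE) mulrACA -invrM ?unitrX // -exprD.
rewrite -rmorphM; apply: away_liftE.
by rewrite [tofrac _]rmorphM exprD -mulf_div -fE -gE.
Qed.

HB.instance Definition _ :=
  GRing.isZmodMorphism.Build (away a) T lift away_lift_is_zmod_morphism.
HB.instance Definition _ := GRing.isMonoidMorphism.Build (away a) T
  lift away_lift_is_monoid_morphism.

End LocalizationLift.

(** * Evaluation at a power series, and Taylor's formula *)

Section Evaluation.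
Variables (D A : comNzRingType) (c : {rmorphism D -> A}).
Implicit Types (f : {fps {poly D}}) (s : {fps A}).

Definition poly_eval s : {poly D} -> {fps A} :=
  horner_eval s \o map_poly (@fpsC A \o c).

HB.instance Definition _ s := GRing.RMorphism.on (poly_eval s).

Definition eval s := fps_lift (poly_eval s).

Definition fps_nderiv j f : {fps {poly D}} :=
  FPS (fun n => (fps_coef f n)^`N(j)).

Lemma eval_trunc N s f n : (n <= N)%N ->
  fps_coef (eval s f) n =
    fps_coef (\sum_(i < N.+1)
      fpsZ ^+ i *: map_poly (@fpsC A \o c) (fps_coef f i)).[s] n.
Proof.
move=> le_nN; rewrite (fps_coef_lift _ _ le_nN) poly_lift_trunc.
congr (fps_coef _ n); rewrite horner_sum; apply: eq_bigr => i _.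
by rewrite hornerZ mulrC.
Qed.

(** For a polynomial in y this is the usual Taylor formula; modulo z^(N+1), f is
    a polynomial in y, but of a degree that depends on N and f, whence w0. *)
Lemma eval_taylor s h f N : exists w0, forall w, (w0 <= w)%N ->
  fps_coef (eval (s + h) f) N =
    fps_coef (\sum_(j < w) eval s (fps_nderiv j f) * h ^+ j) N.
Proof.
pose p := \sum_(i < N.+1) fpsZ ^+ i *: map_poly (@fpsC A \o c) (fps_coef f i).
exists (size p) => w le_pw; rewrite (eval_trunc _ _ (leqnn N)) -/p.
rewrite (nderiv_taylor_wide (mulrC _ _) le_pw) !fps_coef_sum.
apply: eq_bigr => j _; rewrite !fps_coefM; apply: eq_bigr => i _.
rewrite (@eval_trunc N) -1?ltnS //; congr (fps_coef _.[s] i * _).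
rewrite linear_sum; apply: eq_bigr => m _.
by rewrite linearZ /= nderivn_map.
Qed.

(** In the Taylor expansion at s with increment z^k v, the terms of order j < d
    vanish, and those of order j > d are divisible by z^(dk+k), where k > e:
    only the product of the lowest terms of order d reaches degree e + dk. *)
Lemma eval_leading f s v d e k :
    (forall j, (j < d)%N -> eval s (fps_nderiv j f) = 0) ->
    (forall i, (i < e)%N -> fps_coef (eval s (fps_nderiv d f)) i = 0) ->
    (e < k)%N ->
  fps_coef (eval (s + fpsZ ^+ k * v) f) (e + d * k) =
    fps_coef (eval s (fps_nderiv d f)) e * fps_coef v 0 ^+ d.
Proof.
move=> low_d low_e lt_ek; set N := (e + d * k)%N.
have term j : fps_coef (eval s (fps_nderiv j f) * (fpsZ ^+ k * v) ^+ j) N =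
    if j == d then fps_coef (eval s (fps_nderiv d f)) e * fps_coef v 0 ^+ d
    else 0.
  rewrite exprMn -exprM mulrCA fps_coefZnM mulnC.
  have [lt_jd|lt_dj|->] := ltngtP j d.
  - by rewrite low_d // mul0r if_same.
  - rewrite ifT //; apply: (@leq_trans (k + d * k)).
      by rewrite /N ltn_add2r.
    by rewrite -mulSn leq_mul2r lt_dj orbT.
  rewrite ltnNge leq_addl addnK fps_coefM big_ord_recr subnn big1 => [|i _].
    rewrite [LHS]add0r; congr (_ * _); elim: (d) => // m IHm.
    by rewrite !exprS fps_coefM big_ord1 IHm.
  by rewrite low_e ?mul0r ?(ltn_ord i).
have [w0 /(_ (w0 + d.+1)%N (leq_addr _ _)) ->] :=
  eval_taylor s (fpsZ ^+ k * v) f N.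
have lt_d : (d < w0 + d.+1)%N by rewrite addnS ltnS leq_addl.
rewrite fps_coef_sum; under eq_bigr do rewrite term.
rewrite -big_mkcond.
exact: (big_pred1 (Ordinal lt_d)).
Qed.

(** As s vanishes at z = 0, the coefficient of (D_j f)(s) at the z-order m of f
    is the j-th coefficient of f_m.  The index j of the leading one suits. *)
Lemma eval_nderiv_neq0 f s : injective c -> fps_coef s 0 = 0 -> f != 0 ->
  exists j, eval s (fps_nderiv j f) != 0.
Proof.
move=> c_inj s0 /fps_neq0 nz; case: (ex_minnP nz) => m fm minm.
pose j := (size (fps_coef f m)).-1; exists j.
apply/eqP => /fpsP/(_ m)/eqP; rewrite (eval_trunc _ _ (leqnn m)).
rewrite big_ord_recr /= hornerD fps_coefD big1 ?horner0; last first.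
  move=> i _; have /eqP -> : fps_coef f i == 0.
    by apply: contraLR (ltn_ord i) => /minm; rewrite -leqNgt.
  by rewrite linear0 rmorph0 scaler0.
rewrite add0r hornerZ fps_coefZnM ltnn subnn.
set q := map_poly _ _.
have -> : fps_coef q.[s] 0 = fps_coef q`_0 0.
  elim/poly_ind: q => [|r b _]; first by rewrite horner0 coef0.
  rewrite hornerMXaddC coefD coefMX coefC eqxx add0r fps_coefD fps_coefM.
  by rewrite big_ord1 s0 mulr0 add0r.
rewrite coef_map coef_nderivn addn0 binn mulr1n /= mulr1n.
by rewrite -lead_coefE -(rmorph0 c) (inj_eq c_inj) lead_coef_eq0 (negPf fm).
Qed.

End Evaluation.

(** * Series with poles of bounded slope *)

Section Rescaling.
Variables (R : comNzRingType) (a : R).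

Definition fps_rescale (f : {fps R}) : {fps R} :=
  FPS (fun n => a ^+ n * fps_coef f n).

Lemma fps_rescale_is_zmod_morphism : zmod_morphism fps_rescale.
Proof. by move=> f g; apply/fpsP => n; apply: mulrBr. Qed.

Lemma fps_rescale_is_monoid_morphism : monoid_morphism fps_rescale.
Proof.
split=> [|f g]; apply/fpsP => n.
  by case: n => [|n] /=; rewrite ?mulr1 // mulr0.
rewrite [LHS]/= mulr_sumr; apply: eq_bigr => i _ /=.
by rewrite mulrACA -exprD subnKC // -ltnS.
Qed.

HB.instance Definition _ := GRing.isZmodMorphism.Build {fps R} {fps R}
  fps_rescale fps_rescale_is_zmod_morphism.
HB.instance Definition _ := GRing.isMonoidMorphism.Build {fps R} {fps R}
  fps_rescale fps_rescale_is_monoid_morphism.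

End Rescaling.

Section Slope.
Variables (D : idomainType) (t : D) (M : nat).
Local Notation F := {fraction D}.

(** The series g over F such that g(t^M z) has coefficients in D: the poles of
    g_n at t have order at most M n.  Since this is the preimage of a subring
    under a ring morphism, it is a subring. *)
Definition slope : {pred {fps F}} := fun g =>
  `[< exists g' : {fps D},
        fps_rescale (tofrac t ^+ M) g = fps_map (tofrac (R := D)) g' >].

Lemma slope_subring_closed : subring_closed slope.
Proof.
split=> [|f g|f g]; rewrite ?unfold_in.
- by apply/asboolP; exists 1; rewrite !rmorph1.
- move=> /asboolP[f' ff'] /asboolP[g' gg']; apply/asboolP; exists (f' - g').
  rewrite [LHS]rmorphB [RHS]rmorphB; exact: (congr2 (fun x y => x - y) ff' gg').
- move=> /asboolP[f' ff'] /asboolP[g' gg']; apply/asboolP; exists (f' * g').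
  rewrite [LHS]rmorphM [RHS]rmorphM; exact: (congr2 *%R ff' gg').
Qed.

HB.instance Definition _ :=
  GRing.isSubringClosed.Build {fps F} slope slope_subring_closed.

Lemma slopeC (b : D) : fpsC (tofrac b) \in slope.
Proof.
apply/asboolP; exists (fpsC b); apply/fpsP => -[|n] /=; rewrite ?mul1r //.
by rewrite mulr0 rmorph0.
Qed.

Lemma slopeZ : fpsZ \in slope.
Proof.
apply/asboolP; exists (fpsC (t ^+ M) * fpsZ); apply/fpsP => n.
rewrite -[RHS]/(tofrac _) fps_coefCM rmorphM rmorph_nat rmorphXn /=.
by case: n => [|[|n]]; rewrite /= ?mulr0 ?expr1.
Qed.

Lemma slope_coef g n : g \in slope ->
  exists b, (tofrac t ^+ M) ^+ n * fps_coef g n = tofrac b.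
Proof. by case/asboolP => g' /fpsP/(_ n) gE; exists (fps_coef g' n). Qed.

(** The coefficient of f(s) at z^n is that of a polynomial in s and z over D,
    so it suffices that slope is a subring containing D and z. *)
Lemma eval_slope s f : s \in slope -> eval (tofrac (R := D)) s f \in slope.
Proof.
move=> sS.
have truncS N : poly_lift (poly_eval (tofrac (R := D)) s) (fps_trunc N f)
    \in slope.
  rewrite poly_lift_trunc; apply: rpred_sum => i _.
  rewrite rpredM ?rpredX ?slopeZ // rpred_horner //.
  by apply/polyOverP => j; rewrite coef_map slopeC.
have coefS n : exists b,
    (tofrac t ^+ M) ^+ n * fps_coef (eval (tofrac (R := D)) s f) n = tofrac b.
  exact: slope_coef (truncS n).
apply/asboolP; exists (FPS (fun n => projT1 (cid (coefS n)))).
by apply/fpsP => n; rewrite /= -(projT2 (cid (coefS n))).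
Qed.

End Slope.

(** * The lacunary series *)

Section Transcendental.
Variables (D : idomainType) (t : D).
Hypothesis t_neq0 : t != 0.
Hypothesis t_separated :
  forall b : D, (forall n, exists c, b = t ^+ n * c) -> b = 0.
Local Notation F := {fraction D}.
Local Notation eval := (eval (tofrac (R := D))).

Definition pole (n : nat) : nat := (n.*2)`!.

Lemma leq_pole m n : (m <= n)%N -> (pole m <= pole n)%N.
Proof. by move=> le_mn; rewrite leq_fact // leq_double. Qed.

(** The comparison that contradicts the existence of a root: the left pole order
    comes from the truncation of slope pole k, the right one from the first
    omitted term, and n is an arbitrary excess. *)
Lemma pole_growth d e n : (0 < d)%N -> exists2 k, (e <= k)%N &
  (n + pole k * (e + d * k.+2) <= d * pole k.+1)%N.
Proof.
move=> d_gt0; exists (maxn e n); first exact: leq_maxl.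
set k := maxn e n; rewrite /pole doubleS !factS; set a := _`!.
have a_gt0 : (0 < a)%N by rewrite fact_gt0.
have le_e : (e <= d * k)%N.
  by rewrite (leq_trans (leq_maxl e n)) // leq_pmull.
have le_n : (n <= a * (d * k))%N.
  by rewrite (leq_trans (leq_maxr e n)) // mulnA leq_pmull // muln_gt0 a_gt0.
apply: leq_trans (leq_add le_n (leq_mul (leqnn a) (leq_add le_e (leqnn _)))) _.
rewrite -mulnDr -!mulnDr mulnCA leq_mul2l; apply/orP; right.
rewrite mulnA [leqRHS]mulnC leq_mul2l; apply/orP; right.
rewrite -mul2n; nia.
Qed.

(** The root under study is z * lacunary.  The factor z makes it vanish at z = 0
    and removes the pole from its constant term, which no slope allows. *)
Definition lacunary : {fps F} := FPS (fun n => (tofrac t ^+ pole n)^-1).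

Definition lacunary_trunc k : {fps F} :=
  FPS (fun n => if (n < k)%N then fps_coef lacunary n else 0).

Definition lacunary_tail k : {fps F} :=
  FPS (fun n => fps_coef lacunary (k + n)).

Lemma lacunary_split k :
  fpsZ * lacunary_trunc k = fpsZ * lacunary + fpsZ ^+ k.+1 * - lacunary_tail k.
Proof.
rewrite exprS -mulrA -mulrDr; congr (_ * _); apply/fpsP => n.
rewrite fps_coefD fps_coefZnM /=; case: ltnP => [_|le_kn].
  by rewrite addr0.
by rewrite subnKC // subrr.
Qed.

Lemma lacunary_trunc_slope k :
  fpsZ * lacunary_trunc k.+1 \in slope t (pole k).
Proof.
apply/asboolP; exists (FPS (fun n => if n is m.+1 then
  if (m <= k)%N then t ^+ (pole k * m.+1 - pole m) else 0 else 0)).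
apply/fpsP => n; rewrite -[LHS]/(_ * _) -[RHS]/(tofrac _) -(expr1 fpsZ).
rewrite fps_coefZnM; case: n => [|m] /=; first by rewrite mulr0 rmorph0.
rewrite subn1 /= ltnS; case: ifP => [le_mk|_]; last by rewrite mulr0 rmorph0.
rewrite -exprM rmorphXn expfB_cond ?tofrac_eq0 ?(negPf t_neq0) //.
by rewrite (leq_trans (leq_pole le_mk)) // leq_pmulr.
Qed.

Lemma tofrac_inj : injective (tofrac (R := D)).
Proof. by move=> p q /eqP; rewrite tofrac_eq => /eqP. Qed.

(** With d, e and h as in the introduction, comparing the two descriptions of a
    coefficient of f(sigma_k), for varying k, shows that every power of t
    divides h in D; separatedness for the t-adic topology gives h = 0. *)
Lemma eval_lacunary_neq0 (f : {fps {poly D}}) :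
  f != 0 -> eval (fpsZ * lacunary) f != 0.
Proof.
move=> f_neq0; apply/eqP => f_root.
set s := fpsZ * lacunary in f_root.
have s0 : fps_coef s 0 = 0 by rewrite /s -(expr1 fpsZ) fps_coefZnM.
have := eval_nderiv_neq0 tofrac_inj s0 f_neq0.
move=> nz; case: (ex_minnP nz) => d h_neq0 mind.
case: (ex_minnP (fps_neq0 h_neq0)) => e he mine.
have d_gt0 : (0 < d)%N.
  rewrite lt0n; apply: contraNneq h_neq0 => ->.
  have -> : fps_nderiv 0 f = f by apply/fpsP => n; apply: nderivn0.
  by rewrite f_root.
have low_d j : (j < d)%N -> eval s (fps_nderiv j f) = 0.
  move=> lt_jd; apply/eqP; apply: contraLR lt_jd => /mind.
  by rewrite -leqNgt.
have low_e i : (i < e)%N -> fps_coef (eval s (fps_nderiv d f)) i = 0.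
  move=> lt_ie; apply/eqP; apply: contraLR lt_ie => /mine.
  by rewrite -leqNgt.
set h := fps_coef _ e in he.
have h_divisible n : exists b, h = tofrac (t ^+ n * b).
  have [k le_ek le_n] := pole_growth e n d_gt0.
  have := eval_slope f (lacunary_trunc_slope k).
  move=> /(slope_coef (e + d * k.+2)) [b].
  rewrite lacunary_split (eval_leading _ low_d low_e) -/h; last exact: leqW.
  rewrite -[fps_coef _ 0]/(- (tofrac t ^+ pole (k.+1 + 0))^-1) addn0 => hb.
  exists (t ^+ (d * pole k.+1 - (n + pole k * (e + d * k.+2)))
    * ((-1) ^+ d * b)).
  rewrite !tofracM !tofracXn tofracN tofrac1 -hb.
  rewrite [(- _^-1) ^+ d]exprNn exprVn -!exprM [(pole k.+1 * d)%N]mulnC.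
  move: le_n; set N := (pole k * _)%N => le_n.
  set m := (d * _ - _)%N.
  (* The power of t in the witness is chosen so that the three exponents add up
     to the pole order of the first omitted term. *)
  have tE : tofrac t ^+ n * tofrac t ^+ m * tofrac t ^+ N =
      tofrac t ^+ (d * pole k.+1) :> F.
    by rewrite -!exprD addnAC subnKC.
  transitivity (h * ((-1) ^+ d * (-1) ^+ d) *
      (tofrac t ^+ n * tofrac t ^+ m * tofrac t ^+ N
        / tofrac t ^+ (d * pole k.+1))); last by ring.
  by rewrite -expr2 sqrr_sign tE divff ?expf_neq0 ?tofrac_eq0 // !mulr1.
have [b0 hE] := h_divisible 0%N; case/eqP: he; rewrite hE.
rewrite (t_separated (b := t ^+ 0 * b0)) ?rmorph0 // => n.
have [b] := h_divisible n; rewrite hE => /tofrac_inj bE.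
by exists b.
Qed.

End Transcendental.

(** * The prime ideal *)

Section Kernel.
Variables (R : comNzRingType) (S : idomainType) (phi : {rmorphism R -> S}).

Definition rker : {pred R} := fun x => phi x == 0.

Lemma rker_idealr_closed : idealr_closed rker.
Proof.
split; rewrite ?unfold_in ?rmorph0 ?rmorph1 ?oner_eq0 // => a u v.
by rewrite !unfold_in rmorphD rmorphM => /eqP -> /eqP ->; rewrite mulr0 addr0.
Qed.

Lemma rker_prime : prime_idealr_closed rker.
Proof. by move=> u v; rewrite !unfold_in rmorphM mulf_eq0. Qed.

HB.instance Definition _ := isIdealr.Build R rker rker_idealr_closed.
HB.instance Definition _ := isPrimeIdealrClosed.Build R rker rker_prime.

End Kernel.

Section Specialization.
Variable K : fieldType.
Local Notation F := {fraction {poly K}}.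

Definition sigma : {fps F} := fpsZ * lacunary ('X : {poly K}).

Definition specialize : {rmorphism Kxy K -> {fps F}} :=
  poly_eval (tofrac (R := {poly K})) sigma.

Lemma specialize_x : specialize (varx K) = fpsC (tofrac 'X).
Proof.
by rewrite /specialize /= /poly_eval /= horner_evalE map_polyC hornerC.
Qed.

Lemma specialize_y : specialize 'X = sigma.
Proof.
by rewrite /specialize /= /poly_eval /= horner_evalE map_polyX hornerX.
Qed.

Lemma tofracX_neq0 n : tofrac 'X ^+ n != 0 :> F.
Proof. by rewrite expf_neq0 // tofrac_eq0 polyX_eq0. Qed.

Lemma specialize_x_unit : specialize (varx K) \is a GRing.unit.
Proof.
by rewrite specialize_x rmorph_unit // unitfE -(expr1 (tofrac _)) tofracX_neq0.
Qed.

Definition specialize_away : {rmorphism Kxy_x K -> {fps F}} :=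
  away_lift specialize_x_unit.

Definition eval_sigma : {rmorphism {fps Kxy_x K} -> {fps F}} :=
  fps_lift specialize_away.

Lemma specialize_away_poly p :
  specialize_away (to_away (varx K) p) = specialize p.
Proof. exact: away_lift_to_away. Qed.

Lemma x_inverse_away n :
  1 / tofrac (varx K) ^+ n \in away_pred (varx K).
Proof. by apply/asboolP; exists 1, n; rewrite rmorph1. Qed.

Definition x_inverse n : Kxy_x K := Away (x_inverse_away n).

Lemma specialize_x_inverse n :
  specialize_away (x_inverse n) = fpsC ((tofrac 'X ^+ n)^-1).
Proof.
rewrite /specialize_away /= (@away_liftE _ _ _ _ _ _ 1 n) ?rmorph1 //.
by rewrite specialize_x -rmorphXn div1r -rmorphV // unitfE tofracX_neq0.
Qed.

Lemma eval_sigma_extension f :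
  eval_sigma (extension K f) = fps_lift specialize f.
Proof.
apply/fpsP => n; rewrite /eval_sigma [LHS]/= [RHS]/= !poly_lift_trunc.
congr (fps_coef _ n); apply: eq_bigr => i _.
by rewrite -specialize_away_poly.
Qed.

Definition y_sub_sigma : {fps Kxy_x K} :=
  fpsC (to_away (varx K) 'X) - fpsZ * FPS (fun n => x_inverse (pole n)).

Lemma y_sub_sigma_neq0 : y_sub_sigma != 0.
Proof.
apply/eqP => /fpsP/(_ 0%N); rewrite /y_sub_sigma -(expr1 fpsZ).
rewrite -[LHS]/(_ - fps_coef (fpsZ ^+ 1 * _) 0) fps_coefZnM subr0.
rewrite -[RHS](rmorph0 (to_away (varx K))) => /to_away_inj/eqP.
by rewrite polyX_eq0.
Qed.

Lemma eval_sigma_root : eval_sigma y_sub_sigma = 0.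
Proof.
have eval_sigmaZ : eval_sigma fpsZ = fpsZ.
  by apply: fps_lift_const => n; rewrite !rmorph_nat.
have eval_sigma_inverses :
    eval_sigma (FPS (fun n => x_inverse (pole n))) = lacunary 'X.
  by apply: fps_lift_const => n; apply: specialize_x_inverse.
rewrite rmorphB rmorphM eval_sigmaZ eval_sigma_inverses [X in X - _]fps_liftC.
by rewrite specialize_away_poly specialize_y subrr.
Qed.

Lemma polyX_separated (p : {poly K}) :
  (forall n, exists q, p = 'X^n * q) -> p = 0.
Proof.
move=> pX; apply/polyP => i; have [q ->] := pX i.+1.
by rewrite mulrC coefMXn ltnSn coef0.
Qed.

Lemma eval_sigma_extension_neq0 f : f != 0 -> eval_sigma (extension K f) != 0.
Proof.
move=> f_neq0; rewrite eval_sigma_extension.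
apply: eval_lacunary_neq0 f_neq0; last exact: polyX_separated.
by rewrite polyX_eq0.
Qed.

End Specialization.

Theorem corollary5 (K : fieldType) : ~ TGF (extension K) (@extension_inj K).
Proof.
move=> tgf; have [|r r_neq0] := tgf (rker (eval_sigma K)).
  exists (y_sub_sigma K); last exact: y_sub_sigma_neq0.
  by rewrite unfold_in; apply/eqP/eval_sigma_root.
by rewrite unfold_in (negPf (eval_sigma_extension_neq0 r_neq0)).
Qed.
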